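(* For every integer $d\ge 1$ there is a constant $C_d>0$, depending only on $d$, such that the following holds. Let $K$ be a field with $\mathrm{char}(K)=0$ or $\mathrm{char}(K)>d$, let $\overline{K}$ be an algebraic closure of $K$, let $n\ge 1$, and let $f\in K[x_1,\ldots,x_n]_d$ be a form of degree $d$ with $s_{\overline{K}}(f)=r<\infty$. If $K$ is infinite, then $s_K(f)\le C_d\, r^{d-1}$. If $K$ is finite, then $s_K(f)\le C_d\, r^{d-1}\log(r+1)$.
   Context: $K[x_1,\ldots,x_n]_d$ is the space of homogeneous polynomials (forms) of degree $d$ over $K$ (including $0$). The strength $s_K(f)$ of $f\in K[x_1,\ldots,x_n]_d$ is the minimal number $r\geq 0$ of terms in any expression $f=\sum_{i=1}^r a_ib_i$ where the $a_i,b_i$ are forms in $K[x_1,\ldots,x_n]$ of positive degrees; if $d=1$ and $f\ne 0$, then $s_K(f)=\infty$. $s_{\overline{K}}(f)$ denotes the strength of $f$ regarded as a form with coefficients in $\overline{K}$. The logarithm is to base $2$. *)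

(* Defs.v *)
From mathcomp Require Import all_boot all_order all_algebra.
(* mpoly must be imported before the MathComp-Analysis files: in the other
   order their notations clash. *)
From mathcomp Require Import mpoly.
From mathcomp Require Import boolp reals exp.

Set Implicit Arguments.
Unset Strict Implicit.
Unset Printing Implicit Defensive.

Import GRing.Theory.
Local Open Scope ring_scope.

(* 0 is homogeneous of every degree, hence counts as a form here. *)
Definition posdeg_form (n : nat) (K : fieldType) (p : {mpoly K[n]}) : Prop :=
  exists2 e : nat, (0 < e)%N & p \is e.-homog.

Definition sum_of_products (n : nat) (K : fieldType) (f : {mpoly K[n]})
    (r : nat) : Prop :=
  exists a b : 'I_r -> {mpoly K[n]},
    (forall i, posdeg_form (a i) /\ posdeg_form (b i)) /\
    f = \sum_(i < r) a i * b i.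

(* Strength over the field of coefficients of f; None stands for infinity. *)
Definition strength (n : nat) (K : fieldType) (f : {mpoly K[n]}) : option nat :=
  match pselect (exists r, `[< sum_of_products f r >]) with
  | left ex_r => Some (ex_minn ex_r)
  | right _ => None
  end.

Definition is_algebraic_closure (K : fieldType) (L : closedFieldType)
    (iota : {rmorphism K -> L}) : Prop :=
  forall u : L, algebraicOver iota u.

Definition log2 (R : realType) (x : R) : R := ln x / ln 2.

(* Main.v *)
From HB Require Import structures.
Require Import Defs.
From mathcomp Require Import all_boot all_order all_algebra.
From mathcomp Require Import mpoly zify.

Set Implicit Arguments.
Unset Strict Implicit.
Unset Printing Implicit Defensive.

Import GRing.Theory.
Local Open Scope ring_scope.

(** Polarize [f] into the tensor [T] with [T(x,...,x) = d! f(x)].  Over an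
    extension where [f] has strength [r], Leibniz' rule makes each value
    [T(v_1,...,v_d)] a sum of [2^d r] products of two quantities, each of which
    omits at least one of the vectors.  Letting the [i]-th vector range over [m]
    candidates gives [m^d] values that depend on only [O(r m^(d-1))] parameters,
    so for [m] a large multiple of [r] they satisfy a nontrivial relation
    [h = 0], which can be taken multilinear in the values and with coefficients
    in [K].  Passing to partial derivatives of [h] while they still vanish
    identically, we reach an [h] vanishing for all vectors while some [dh/dz_J]
    does not vanish for a suitable choice [v] of vectors.  Add a generic point [x]
    to the vectors in the slots of [J]: modulo the ideal generated by the mixed
    values of [T] ([x] in some but not all slots, vectors from [v] in the others),
    the relation becomes [d! f(x) dh/dz_J (v) = 0].  There are at most
    [2^d m^(d-1)] mixed values, and they are forms of degree between [1] and [d-1].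

    When [K] is small, the vectors [v] are taken with coordinates in [K[t]] of
    degree less than [k], of which there are enough as soon as [2^k] exceeds the
    degree [d m^d] of the relation; comparing coefficients of powers of [t] then
    costs a factor [O(k) = O(log(r+1))]. *)

(** * Polarization *)

Definition fcons (T : Type) (n : nat) (x : T) (k : {ffun 'I_n -> T}) :
    {ffun 'I_n.+1 -> T} :=
  [ffun i => oapp k x (unlift ord0 i)].

Lemma fcons0 (T : Type) (n : nat) (x : T) (k : {ffun 'I_n -> T}) :
  fcons x k ord0 = x.
Proof. by rewrite ffunE unlift_none. Qed.

Lemma fconsS (T : Type) (n : nat) (x : T) (k : {ffun 'I_n -> T}) (i : 'I_n) :
  fcons x k (lift ord0 i) = k i.
Proof. by rewrite ffunE liftK. Qed.

Lemma big_fcons (V : nmodType) (T : finType) (n : nat)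
    (F : {ffun 'I_n.+1 -> T} -> V) :
  \sum_k F k = \sum_x \sum_k F (fcons x k).
Proof.
rewrite pair_big (reindex (fun p : T * {ffun 'I_n -> T} => fcons p.1 p.2)) //=.
exists (fun k : {ffun 'I_n.+1 -> T} => (k ord0, [ffun i => k (lift ord0 i)])).
  case=> x k _ /=; rewrite fcons0; congr (_, _); apply/ffunP => i.
  by rewrite ffunE fconsS.
move=> k _ /=; apply/ffunP => i; case: (unliftP ord0 i) => [j|] ->.
  by rewrite fconsS ffunE.
by rewrite fcons0.
Qed.

Section Polarization.

Variable n : nat.

Definition dirder (R : comNzRingType) (y : 'I_n -> R) (g : {mpoly R[n]}) :=
  \sum_j y j *: g^`M(j).

Definition polar (R : comNzRingType) (ys : seq ('I_n -> R)) (g : {mpoly R[n]}) :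
    R :=
  (foldl (fun g y => dirder y g) g ys)@_0%MM.

Lemma dirder_is_linear (R : comNzRingType) (y : 'I_n -> R) : linear (dirder y).
Proof.
move=> c p q; rewrite /dirder scaler_sumr -big_split; apply: eq_bigr => j _ /=.
by rewrite mderivD mderivZ scalerDr !scalerA mulrC.
Qed.

HB.instance Definition _ (R : comNzRingType) (y : 'I_n -> R) :=
  GRing.isLinear.Build R {mpoly R[n]} {mpoly R[n]} _ (dirder y)
    (dirder_is_linear y).

Lemma dirderM (R : comNzRingType) (y : 'I_n -> R) (p q : {mpoly R[n]}) :
  dirder y (p * q) = dirder y p * q + p * dirder y q.
Proof.
rewrite /dirder mulr_suml mulr_sumr -big_split; apply: eq_bigr => j _ /=.
by rewrite mderivM scalerDr -scalerAl -scalerAr.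
Qed.

Lemma polar_cons (R : comNzRingType) y ys (g : {mpoly R[n]}) :
  polar (y :: ys) g = polar ys (dirder y g).
Proof. by []. Qed.

Lemma polar_is_scalar (R : comNzRingType) (ys : seq ('I_n -> R)) :
  scalar (polar ys).
Proof.
elim: ys => [|y ys IH] c p q; first by rewrite /polar /= mcoeffD mcoeffZ.
by rewrite !polar_cons linearP IH.
Qed.

HB.instance Definition _ (R : comNzRingType) (ys : seq ('I_n -> R)) :=
  GRing.isLinear.Build R {mpoly R[n]} R _ (polar ys) (@polar_is_scalar R ys).

Lemma polar_dirder_map (K R : comNzRingType) (phi : {rmorphism K -> R})
    (f : {mpoly K[n]}) y ys :
  polar ys (dirder y (map_mpoly phi f)) =
  \sum_j y j * polar ys (map_mpoly phi f^`M(j)).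
Proof.
rewrite /dirder raddf_sum; apply: eq_bigr => j _ /=; rewrite linearZ /=.
congr (_ * polar _ _); apply/mpolyP => m.
by rewrite mcoeff_deriv !mcoeff_map_mpoly mcoeff_deriv raddfMn.
Qed.

Lemma polarM (R : comNzRingType) d (Y : 'I_d -> 'I_n -> R) (p q : {mpoly R[n]}) :
  polar [seq Y i | i <- enum 'I_d] (p * q) =
  \sum_(S : {ffun 'I_d -> bool})
     polar [seq Y i | i <- enum 'I_d & S i] p *
     polar [seq Y i | i <- enum 'I_d & ~~ S i] q.
Proof.
elim: d Y p q => [|d IH] Y p q.
  rewrite (big_pred1 [ffun=> true]); last first.
    by move=> S; apply/esym/eqP/ffunP => -[].
  by rewrite !enum_ord0 /polar /= mcoeff0_is_multiplicative.
have E s : [seq Y i | i <- map (lift ord0) s] = [seq Y (lift ord0 i) | i <- s].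
  by rewrite -map_comp.
rewrite enum_ordSl /= polar_cons dirderM raddfD /= E.
have F (P : bool -> bool) b (S : {ffun 'I_d -> bool}) :
    [seq Y i | i <- map (lift ord0) (enum 'I_d) & P (fcons b S i)] =
    [seq Y (lift ord0 i) | i <- enum 'I_d & P (S i)].
  rewrite filter_map E (@eq_filter _ _ (fun i => P (S i))) // => i /=.
  by rewrite fconsS.
rewrite !(IH (fun i => Y (lift ord0 i))) big_fcons big_bool /=.
congr (_ + _); apply: eq_bigr => S _; rewrite fcons0 /=.
  by rewrite (F id) (F negb).
by rewrite (F id) (F negb).
Qed.

Definition tensor d (K : comNzRingType) (f : {mpoly K[n]})
    (k : {ffun 'I_d -> 'I_n}) : K :=
  (foldl (fun g j => g^`M(j)) f [seq k i | i <- enum 'I_d])@_0%MM.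

Definition tensor_eval d (K R : comNzRingType) (phi : K -> R)
    (T : {ffun 'I_d -> 'I_n} -> K) (Y : 'I_d -> 'I_n -> R) : R :=
  \sum_k phi (T k) * \prod_i Y i (k i).

Lemma polarE d (K R : comNzRingType) (phi : {rmorphism K -> R})
    (f : {mpoly K[n]}) (Y : 'I_d -> 'I_n -> R) :
  polar [seq Y i | i <- enum 'I_d] (map_mpoly phi f) =
  tensor_eval phi (tensor f) Y.
Proof.
elim: d Y f => [|d IH] Y f; rewrite /tensor_eval.
  rewrite (big_pred1 [ffun i : 'I_0 => False_rect _ (notF (ltn_ord i))]);
    last by move=> S; apply/esym/eqP/ffunP => -[].
  by rewrite big_ord0 mulr1 /tensor !enum_ord0 /polar /= mcoeff_map_mpoly.
have E s : [seq Y i | i <- map (lift ord0) s] = [seq Y (lift ord0 i) | i <- s].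
  by rewrite -map_comp.
rewrite enum_ordSl /= polar_cons polar_dirder_map E big_fcons.
apply: eq_bigr => j _; rewrite (IH (fun i => Y (lift ord0 i))) mulr_sumr.
apply: eq_bigr => k _.
rewrite mulrCA big_ord_recl fcons0 /tensor enum_ordSl /= fcons0 -map_comp.
congr (phi (foldl _ _ _)@_0%MM * (_ * _)).
  by apply: eq_map => i /=; rewrite fconsS.
by apply: eq_bigr => i _; rewrite fconsS.
Qed.

Lemma mpoly_Euler (K : comNzRingType) d (f : {mpoly K[n]}) : f \is d.-homog ->
  \sum_j 'X_j * f^`M(j) = f *+ d.
Proof.
move=> /dhomogP hf; rewrite [f in RHS]mpolyE -sumrMnl.
transitivity
  (\sum_(m <- msupp f) f@_m *: \sum_j 'X_j * 'X_[m]^`M(j) : {mpoly K[n]}).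
  under [RHS]eq_bigr do rewrite scaler_sumr.
  rewrite exchange_big; apply: eq_bigr => j _ /=.
  rewrite [f in LHS]mpolyE raddf_sum mulr_sumr; apply: eq_bigr => m _ /=.
  by rewrite mderivZ scalerAr.
rewrite big_seq [RHS]big_seq; apply: eq_bigr => m /hf <- /=.
rewrite scalerMnr; congr (_ *: _); rewrite mdegE -sumrMnr; apply: eq_bigr => j _.
rewrite mderivX -scalerAr scaler_nat -mpolyXD.
have [->|mj] := eqVneq (m j) 0%N; first by rewrite !mulr0n.
rewrite addmC submK //; apply/mnm_lepP => i; rewrite mnm1E.
by case: eqP => [<-|//]; rewrite lt0n.
Qed.

Lemma tensor_eval_diag (K : comNzRingType) d (f : {mpoly K[n]}) : f \is d.-homog ->
  tensor_eval (@mpolyC n K) (@tensor d K f) (fun _ j => 'X_j) = f *+ d`!.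
Proof.
have -> : tensor_eval (@mpolyC n K) (@tensor d K f) (fun _ j => 'X_j) =
    polar (nseq d (fun j => 'X_j)) (map_mpoly (@mpolyC n K) f).
  rewrite -polarE -[d in nseq d _]size_enum_ord; congr polar.
  by elim: (enum 'I_d) => //= i s ->.
elim: d f => [|d IH] f hf.
  rewrite /polar /= mcoeff_map_mpoly mulr1n; apply/esym/mpolyP => m.
  rewrite mcoeffC; case: eqVneq => [->|nz]; first by rewrite mulr1.
  by rewrite mulr0 (dhomog_nemf_coeff hf) // mdeg_eq0.
rewrite /= polar_cons polar_dirder_map factS mulrnA -(mpoly_Euler hf).
rewrite -sumrMnl; apply: eq_bigr => j _; rewrite IH ?mulrnAr //.
apply/dhomogP => m; rewrite mcoeff_msupp mcoeff_deriv => nz.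
have /(dhomogP _ _ _ hf) : (m + U_(j))%MM \in msupp f.
  by rewrite mcoeff_msupp; apply: contraNneq nz => ->; rewrite mul0rn.
by move=> /=; rewrite mdegD mdeg1 addn1 => -[].
Qed.
End Polarization.

(** * Multilinear relations *)

Lemma bin_lt_exp2 (M N : nat) : (0 < N)%N -> (6 * M <= N)%N ->
  ('C(M + 2 * N, M) < 2 ^ N)%N.
Proof.
move=> N_gt0 leMN.
have le3 : ('C(M + 2 * N, M) * 2 ^ (6 * N) <= 3 ^ (2 * M + 4 * N))%N.
  (* One term of the binomial expansion of [(8 + 1)^(M + 2N)]. *)
  have -> : (3 ^ (2 * M + 4 * N) = (8 + 1) ^ (M + 2 * N))%N.
    have -> : (8 + 1 = 3 ^ 2)%N by [].
    by rewrite -expnM; congr expn; lia.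
  have ltM : (M < (M + 2 * N).+1)%N by rewrite ltnS leq_addr.
  rewrite expnDn (bigD1 (Ordinal ltM)) //= exp1n muln1 addKn.
  have -> : (8 = 2 ^ 3)%N by [].
  by rewrite -expnM mulnA leq_addr.
have lt32 : (3 ^ (2 * M + 4 * N) < 2 ^ (7 * N))%N.
  rewrite -(@ltn_exp2r _ _ 6) // -!expnM.
  (* [3^5 < 2^8] and [3 < 2^2] give [3^26 < 2^42]. *)
  apply: (@leq_ltn_trans (3 ^ (5 * (5 * N) + N))).
    by rewrite leq_exp2l //; lia.
  have -> : (7 * N * 6 = 8 * (5 * N) + 2 * N)%N by lia.
  rewrite expnD (expnM 3 5) expnD (expnM 2 8) (expnM 2 2).
  by apply: ltn_mul; rewrite ltn_exp2r // muln_gt0.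
have := leq_ltn_trans le3 lt32; rewrite (mulnDl 1 6) expnD mul1n ltn_pmul2r //.
by rewrite expn_gt0.
Qed.

Definition sqfree_eval (Om : finType) (K R : comNzRingType) (phi : K -> R)
    (h : {ffun {set Om} -> K}) (z : Om -> R) : R :=
  \sum_(A : {set Om}) phi (h A) * \prod_(w in A) z w.

Lemma msizeM_leq (n D E : nat) (K : idomainType) (p q : {mpoly K[n]}) :
  (msize p <= D.+1 -> msize q <= E.+1 -> msize (p * q) <= (D + E).+1)%N.
Proof.
move=> leD leE; have [->|nzp] := eqVneq p 0; first by rewrite mul0r msize0.
have [->|nzq] := eqVneq q 0; first by rewrite mulr0 msize0.
by rewrite msizeM //; lia.
Qed.

Lemma msize_prod_leq (n D : nat) (K : idomainType) (I : finType) (A : {pred I})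
    (p : I -> {mpoly K[n]}) :
  (forall i, msize (p i) <= D.+1)%N ->
  (msize (\prod_(i in A) p i) <= (D * #|A|).+1)%N.
Proof.
move=> hp; rewrite -sum1_card big_distrr /=.
elim/big_rec2: _ => [|i k q _ IH]; first by rewrite msize1.
by rewrite muln1 msizeM_leq.
Qed.

(* There are [2^#|Om|] squarefree monomials in the sums of products, but these
   have degree at most [2 #|Om|] in only [#|P|] parameters. *)
Lemma sqfree_relation (K : fieldType) (Om P Q : finType) (u w : Q -> Om -> P) :
  (0 < #|Om|)%N -> (6 * #|P| <= #|Om|)%N ->
  exists2 h : {ffun {set Om} -> K}, h != 0 &
    forall (R : comNzRingType) (phi : {rmorphism K -> R}) (a : P -> R),
      sqfree_eval phi h (fun o => \sum_q a (u q o) * a (w q o)) = 0.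
Proof.
set M := #|P|; set N := #|Om| => N_gt0 leMN.
pose X (p : P) : {mpoly K[M]} := 'X_(enum_rank p).
pose z o := \sum_q X (u q o) * X (w q o).
pose pr (A : {set Om}) := \prod_(o in A) z o.
have szX p : msize (X p) = 2%N by rewrite /X msizeX mdeg1.
have sz_pr A : (msize (pr A) <= (2 * N).+1)%N.
  apply: leq_trans (msize_prod_leq (D := 2) _ _) _ => [o|]; last first.
    by rewrite ltnS leq_mul2l max_card.
  apply: leq_trans (mmeasure_sum _ _ _ _) _; apply/bigmax_leqP => q _.
  by apply: (@msizeM_leq _ 1 1); rewrite szX.
pose Mon := [set t : M.-tuple 'I_(2 * N).+1 | (\sum_(i <- t) i <= 2 * N)%N].
pose mon (t : M.-tuple 'I_(2 * N).+1) : 'X_{1..M} :=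
  [multinom (tnth t i : nat) | i < M].
pose C := \matrix_(i < #|{set Om}|, j < #|Mon|)
  (pr (enum_val i))@_(mon (enum_val j)).
have /rowV0Pn [v /sub_kermxP vC nzv] : kermx C != 0.
  rewrite -mxrank_eq0 mxrank_ker -lt0n subn_gt0.
  apply: leq_ltn_trans (rank_leq_col _) _.
  rewrite card_partial_ord_partitions -cardsT -powersetT card_powerset cardsT.
  exact: bin_lt_exp2.
exists [ffun A => v 0 (enum_rank A)].
  apply: contraNneq nzv => /ffunP v0; apply/eqP/rowP => i.
  by have := v0 (enum_val i); rewrite !ffunE enum_valK mxE.
move=> R phi a.
have relX : \sum_A v 0 (enum_rank A) *: pr A = 0.
  apply/mpolyP => m; rewrite mcoeff0 raddf_sum /=.
  have [lem|ltm] := leqP (mdeg m) (2 * N); last first.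
    apply: big1 => A _; rewrite mcoeffZ.
    by rewrite memN_msupp_eq0 ?mulr0 // msize_mdeg_ge // (leq_trans (sz_pr A)).
  have ltmi i : (m i < (2 * N).+1)%N.
    by rewrite ltnS (leq_trans _ lem) // mdegE (bigD1 i) //= leq_addr.
  pose t := [tuple Ordinal (ltmi i) | i < M].
  have tMon : t \in Mon.
    by rewrite inE big_tuple (eq_bigr m) -?mdegE // => i _; rewrite tnth_mktuple.
  transitivity ((v *m C) 0 (enum_rank_in tMon t)); last by rewrite vC mxE.
  rewrite mxE (reindex (fun i : 'I_#|{set Om}| => enum_val i)) /=; last first.
    exact/onW_bij/enum_val_bij.
  apply: eq_bigr => i _; rewrite mxE mcoeffZ enum_valK enum_rankK_in //.
  congr (_ * _@__); apply/mnmP => i'; by rewrite mnmE tnth_mktuple.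
pose ev : {mpoly K[M]} -> R := mmap phi (fun i : 'I_#|P| => a (enum_val i)).
have evX p : ev (X p) = a p by rewrite /ev /X mmapX mmap1U enum_rankK.
transitivity (ev (\sum_A v 0 (enum_rank A) *: pr A)); last first.
  by rewrite relX /ev mmap0.
rewrite /ev raddf_sum; apply: eq_bigr => A _ /=.
rewrite ffunE mmapZ rmorph_prod; congr (_ * _); apply: eq_bigr => o _.
rewrite rmorph_sum; apply: eq_bigr => q _ /=.
by rewrite rmorphM /= -/ev !evX.
Qed.

Lemma coef_grid_eq0 (R : idomainType) (n D : nat) (E : seq R)
    (c : {ffun 'I_n -> 'I_D} -> R) :
  uniq E -> (D <= size E)%N ->
  (forall x : 'I_n -> R, (forall i, x i \in E) ->
     \sum_k c k * \prod_i x i ^+ k i = 0) ->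
  forall k, c k = 0.
Proof.
move=> uE leD; elim: n c => [|n IH] c c0 k.
  rewrite -[RHS](c0 (fun=> 0)) => [|[]//]; rewrite (big_pred1 k) => [|k'].
    by rewrite big_ord0 mulr1.
  by apply/esym/eqP/ffunP => -[].
have -> : k = fcons (k ord0) [ffun i => k (lift ord0 i)].
  apply/ffunP => i; case: (unliftP ord0 i) => [j|] ->; last by rewrite fcons0.
  by rewrite fconsS ffunE.
move: (k ord0) (finfun _) => a k' {k}.
apply: (IH (fun k' => c (fcons a k'))) => x xE.
pose q a := \sum_k c (fcons a k) * \prod_i x i ^+ k i : R.
pose p := \poly_(i < D) oapp q 0 (insub i).
have pE (i : 'I_D) : p`_i = q i by rewrite coef_poly ltn_ord valK.
suff p0 : p = 0 by have := pE a; rewrite p0 coef0.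
apply/eqP; apply: contraTT uE => nzp; apply/negP => uE.
have := max_poly_roots nzp _ uE; rewrite ltnNge (leq_trans (size_poly _ _) leD).
suff -> : all (root p) E by move=> /(_ isT).
apply/allP => y yE; apply/eqP.
rewrite (horner_coef_wide _ (size_poly _ _)).
rewrite -[RHS](c0 (fun i => oapp x y (unlift ord0 i))); last first.
  by move=> i; case: (unlift ord0 i) => [j|] /=.
rewrite big_fcons; apply: eq_bigr => i _; rewrite pE mulr_suml.
apply: eq_bigr => l _; rewrite big_ord_recl unlift_none fcons0 /= mulrAC -mulrA.
congr (_ * (_ * _)).
by apply: eq_bigr => j _; rewrite liftK fconsS.
Qed.

Lemma mpoly_grid_eq0 (R : idomainType) (n : nat) (E : seq R) (p : {mpoly R[n]}) :
  uniq E -> (msize p <= size E)%N ->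
  (forall x : 'I_n -> R, (forall i, x i \in E) -> p.@[x] = 0) -> p = 0.
Proof.
move=> uE leD p0; pose D := msize p.
pose mon (k : {ffun 'I_n -> 'I_D}) : 'X_{1..n} := [multinom (k i : nat) | i < n].
have inj_mon : injective mon.
  move=> k l /mnmP eq_kl; apply/ffunP => i; apply/val_inj.
  by have := eq_kl i; rewrite !mnmE.
have monP m : m \in msupp p -> exists k, m = mon k.
  move=> /msize_mdeg_lt ltm.
  have lti i : (m i < D)%N.
    by apply: leq_ltn_trans ltm; rewrite mdegE (bigD1 i) //= leq_addr.
  exists [ffun i => Ordinal (lti i)]; apply/mnmP => i.
  by rewrite mnmE ffunE.
have c0 k : p@_(mon k) = 0.
  move: k; apply: (coef_grid_eq0 uE leD) => x xE; rewrite -[RHS](p0 x xE) mevalE.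
  rewrite (bigID (fun k => mon k \in msupp p)) /= addrC.
  rewrite big1 ?add0r => [|k]; last first.
    by move=> /memN_msupp_eq0 ->; rewrite mul0r.
  under eq_bigr => k _ do under eq_bigr => i _ do
    rewrite -[k i : nat](mnmE (fun i => k i : nat)).
  rewrite -(big_map mon (mem (msupp p)) (fun m => p@_m * \prod_i x i ^+ m i)).
  rewrite -big_filter; apply: perm_big; apply: uniq_perm.
  - by rewrite filter_uniq // map_inj_uniq // index_enum_uniq.
  - exact: msupp_uniq.
  move=> m; rewrite mem_filter /=; apply: andb_idr => /monP[k ->].
  by rewrite map_f // mem_index_enum.
apply/mpolyP => m; rewrite mcoeff0.
case: (boolP (m \in msupp p)) => [/monP[k ->] //|/memN_msupp_eq0 //].
Qed.

(* Being squarefree, a nonconstant relation has a nonzero derivative in every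
   characteristic. *)
Definition sqfree_deriv (Om : finType) (K : comNzRingType) (o : Om)
    (h : {ffun {set Om} -> K}) : {ffun {set Om} -> K} :=
  [ffun A : {set Om} => if o \in A then 0 else h (o |: A)].

Lemma sqfree_eval_shift (Om : finType) (K R : comNzRingType)
    (phi : {rmorphism K -> R}) (h : {ffun {set Om} -> K}) (z : Om -> R) (o : Om) (y : R) :
  sqfree_eval phi h (fun w => z w + (if w == o then y else 0)) =
  sqfree_eval phi h z + y * sqfree_eval phi (sqfree_deriv o h) z.
Proof.
rewrite /sqfree_eval mulr_sumr.
rewrite [X in _ = _ + X](bigID (fun A : {set Om} => o \in A)) /=.
rewrite [X in _ = _ + (X + _)]big1 ?add0r => [|A oA]; last first.
  by rewrite ffunE oA rmorph0 mul0r mulr0.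
rewrite [LHS](bigID (fun A : {set Om} => o \in A)) /=.
rewrite [X in _ = X + _](bigID (fun A : {set Om} => o \in A)) /= -addrA.
rewrite [X in _ = _ + X]addrC [RHS]addrA; congr (_ + _); last first.
  apply: eq_bigr => A oA; congr (_ * _); apply: eq_bigr => w wA.
  by case: eqP => [eq_wo|_]; rewrite ?addr0 //; rewrite -eq_wo wA in oA.
rewrite [X in _ = _ + X](reindex_onto (fun A => A :\ o) (fun A => o |: A)) /=.
  rewrite [X in _ = _ + X](eq_bigl (fun A : {set Om} => o \in A)) => [|A]; last first.
    rewrite !inE eqxx /=; apply/eqP/idP => [<-|/setD1K //].
    by rewrite !inE eqxx.
  rewrite -big_split; apply: eq_bigr => A oA /=.
  rewrite ffunE !inE eqxx /= setD1K // !(big_setD1 o oA) /= eqxx.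
  rewrite (eq_bigr z) => [|w]; last first.
    by rewrite !inE => /andP[/negPf -> _]; rewrite addr0.
  by rewrite mulrDl mulrDr; congr (_ + _); rewrite mulrCA.
by move=> A oA; rewrite setU1K.
Qed.

Lemma sqfree_relation_descent (Om : finType) (K : fieldType) (R : comNzRingType)
    (phi : {rmorphism K -> R}) (V : Type) (v : V) (z : V -> Om -> R)
    (h : {ffun {set Om} -> K}) :
  h != 0 -> (forall v, sqfree_eval phi h (z v) = 0) ->
  exists (h' : {ffun {set Om} -> K}) (o : Om) (v' : V),
    (forall v, sqfree_eval phi h' (z v) = 0) /\
    sqfree_eval phi (sqfree_deriv o h') (z v') != 0.
Proof.
have [N] : exists N, forall A : {set Om}, h A != 0 -> (#|A| <= N)%N.
  by exists #|Om| => A _; apply: max_card.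
elim: N h => [|N IH] h hN nzh h0.
  have hA A : A != set0 -> h A = 0.
    by rewrite -card_gt0; apply: contraTeq => /hN; rewrite leqn0 => /eqP ->.
  have := h0 v; rewrite /sqfree_eval (bigD1 set0) //=.
  rewrite [X in _ + X]big1 => [|A nzA]; last first.
    by rewrite hA // rmorph0 mul0r.
  rewrite big_set0 mulr1 addr0 => /eqP; rewrite fmorph_eq0 => /eqP hs0.
  case/eqP: nzh; apply/ffunP => A; rewrite ffunE.
  by have [->|/hA] := eqVneq A set0.
case: (pickP (fun A : {set Om} => (h A != 0) && (A != set0))) => [A|hA]; last first.
  apply: (IH h) => // A nzhA; have := hA A; rewrite nzhA /= => /negbFE/eqP ->.
  by rewrite cards0.
case/andP=> nzhA /set0Pn[o oA].
have [dh0|] :=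
  boolp.pselect (forall v, sqfree_eval phi (sqfree_deriv o h) (z v) = 0).
  apply: (IH (sqfree_deriv o h)) => // [B|].
    rewrite ffunE; case: ifPn => [_|oB /hN]; first by rewrite eqxx.
    by rewrite cardsU1 oB.
  apply: contraNneq nzhA => /ffunP/(_ (A :\ o)).
  by rewrite !ffunE !inE eqxx /= setD1K // => ->.
move=> /boolp.existsNP[v' /eqP nz]; by exists h, o, v'.
Qed.

Lemma tensor_eval_morph (n d : nat) (K R R' : comNzRingType) (phi : K -> R)
    (phi' : K -> R') (chi : {rmorphism R -> R'}) (T : {ffun 'I_d -> 'I_n} -> K)
    (Y : 'I_d -> 'I_n -> R) (Y' : 'I_d -> 'I_n -> R') :
  (forall c, chi (phi c) = phi' c) -> (forall i l, chi (Y i l) = Y' i l) ->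
  chi (tensor_eval phi T Y) = tensor_eval phi' T Y'.
Proof.
move=> hphi hY; rewrite rmorph_sum; apply: eq_bigr => k _.
by rewrite rmorphM /= hphi rmorph_prod; congr (_ * _); apply: eq_bigr.
Qed.

Lemma sqfree_eval_morph (Om : finType) (K R R' : comNzRingType) (phi : K -> R)
    (phi' : K -> R') (chi : {rmorphism R -> R'}) (h : {ffun {set Om} -> K})
    (z : Om -> R) (z' : Om -> R') :
  (forall c, chi (phi c) = phi' c) -> (forall o, chi (z o) = z' o) ->
  chi (sqfree_eval phi h z) = sqfree_eval phi' h z'.
Proof.
move=> hphi hz; rewrite rmorph_sum; apply: eq_bigr => A _.
by rewrite rmorphM /= hphi rmorph_prod; congr (_ * _); apply: eq_bigr.
Qed.

Lemma eq_sqfree_eval (Om : finType) (K R : comNzRingType) (phi : K -> R)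
    (h : {ffun {set Om} -> K}) (z z' : Om -> R) :
  z =1 z' -> sqfree_eval phi h z = sqfree_eval phi h z'.
Proof.
by move=> eqz; apply: eq_bigr => A _; congr (_ * _); apply: eq_bigr.
Qed.

Definition drop_slot (m e : nat) (i0 : 'I_e.+1) (J : {ffun 'I_e.+1 -> 'I_m}) :
    {ffun 'I_e -> 'I_m} :=
  [ffun j => J (lift i0 j)].

(* The entry in slot [i0] is the irrelevant default [j0]. *)
Definition fill_slot (m e : nat) (j0 : 'I_m) (i0 : 'I_e.+1)
    (J : {ffun 'I_e -> 'I_m}) (i : 'I_e.+1) : 'I_m :=
  oapp J j0 (unlift i0 i).

Lemma drop_slotK (m e : nat) (j0 : 'I_m) (i0 i : 'I_e.+1)
    (J : {ffun 'I_e.+1 -> 'I_m}) :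
  i != i0 -> fill_slot j0 i0 (drop_slot i0 J) i = J i.
Proof.
rewrite eq_sym /fill_slot => /unlift_some[j -> ->] /=.
by rewrite ffunE.
Qed.

Lemma tensor_relation (K L : fieldType) (iota : {rmorphism K -> L}) (n e r m : nat)
    (f : {mpoly K[n]}) (a b : 'I_r -> {mpoly L[n]}) :
  (forall i, (a i)@_0%MM = 0) -> (forall i, (b i)@_0%MM = 0) ->
  map_mpoly iota f = \sum_i a i * b i ->
  (0 < m)%N -> (6 * (r * 2 ^ e.+1 * 2 * m ^ e) <= m ^ e.+1)%N ->
  exists2 h : {ffun {set {ffun 'I_e.+1 -> 'I_m}} -> K}, h != 0 &
    forall v : 'I_e.+1 -> 'I_m -> 'I_n -> {poly K},
      sqfree_eval polyC h
        (fun J => tensor_eval polyC (tensor f) (fun i => v i (J i))) = 0.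
Proof.
move=> a0 b0 def_f m_gt0 le_m.
pose j0 := Ordinal m_gt0; pose d := e.+1.
pose slot (S : pred 'I_d) : 'I_d := odflt ord0 [pick i | ~~ S i].
have slotP (S : pred 'I_d) i : ~~ S i -> ~~ S (slot S).
  by rewrite /slot => nSi; case: pickP => [//|/(_ i)]; rewrite nSi.
pose P := ('I_r * {ffun 'I_d -> bool} * bool * {ffun 'I_e -> 'I_m})%type.
pose Q := ('I_r * {ffun 'I_d -> bool})%type.
pose u (q : Q) (J : {ffun 'I_d -> 'I_m}) : P :=
  (q.1, q.2, true, drop_slot (slot q.2) J).
pose w (q : Q) (J : {ffun 'I_d -> 'I_m}) : P :=
  (q.1, q.2, false, drop_slot (slot (fun i => ~~ q.2 i)) J).
have [||h nzh h0] := @sqfree_relation K {ffun 'I_d -> 'I_m} P Q u w.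
- by rewrite card_ffun !card_ord expn_gt0 m_gt0.
- by rewrite !card_prod !card_ffun !card_ord card_bool.
exists h => // v; apply/eqP.
rewrite -(map_poly_eq0 iota); apply/eqP.
pose phi : {rmorphism K -> {poly L}} := polyC \o iota.
pose v' i j l := map_poly iota (v i j l).
rewrite (@sqfree_eval_morph _ _ _ _ _ phi _ _ _
  (fun J : {ffun 'I_d -> 'I_m} =>
    tensor_eval phi (tensor f) (fun i => v' i (J i)))); first last.
- by move=> J; apply: tensor_eval_morph => [c|//]; rewrite /= map_polyC.
- by move=> c; rewrite /= map_polyC.
pose al (p : P) : {poly L} := let: (i, W, side, J) := p in
  if side then
    polar [seq v' t (fill_slot j0 (slot W) J t) | t <- enum 'I_d & W t]
      (map_mpoly polyC (a i))
  else
    polar [seq v' t (fill_slot j0 (slot (fun t => ~~ W t)) J t)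
          | t <- enum 'I_d & ~~ W t]
      (map_mpoly polyC (b i)).
rewrite -[RHS](h0 _ phi al); apply: eq_sqfree_eval => J.
rewrite -polarE.
have -> : map_mpoly phi f = \sum_i map_mpoly polyC (a i) * map_mpoly polyC (b i).
  under eq_bigr do rewrite -rmorphM; rewrite -raddf_sum -def_f.
  by apply/mpolyP => mm; rewrite !mcoeff_map_mpoly.
rewrite raddf_sum -(pair_bigA _ (fun i S => al (u (i, S) J) * al (w (i, S) J))) /=.
apply: eq_bigr => i _.
rewrite (@polarM _ _ _ (fun i => v' i (J i))); apply: eq_bigr => S _.
have seqE (S' : pred 'I_d) :
    [seq v' t (fill_slot j0 (slot S') (drop_slot (slot S') J) t)
    | t <- enum 'I_d & S' t] =
      [seq v' t (J t) | t <- enum 'I_d & S' t] \/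
    [seq t <- enum 'I_d | ~~ S' t] = [::].
  case: (pickP (fun t => ~~ S' t)) => [t nS't|S'T]; [left|right].
    apply/eq_in_map => x; rewrite mem_filter => /andP[S'x _].
    by rewrite drop_slotK //; apply: contraTneq S'x => ->; exact: slotP nS't.
  by rewrite (eq_filter S'T) filter_pred0.
have polar_nil g :
    g@_0%MM = 0 -> polar [::] (map_mpoly (@polyC L) g) = 0 :> {poly L}.
  by rewrite /polar /= mcoeff_map_mpoly => ->.
rewrite /al /u /w /=.
case: (seqE S) => [->|->]; last by rewrite /= polar_nil // !mulr0.
case: (seqE (fun t => ~~ S t)) => [-> //|].
under eq_filter do rewrite negbK; move=> ->.
by rewrite /= polar_nil // !mul0r.
Qed.

(** * The ideal of mixed values *)

Definition in_span (R : comNzRingType) (I : finType) (g : I -> R) (y : R) : Prop :=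
  exists B : I -> R, y = \sum_i g i * B i.

Section Span.

Variables (R : comNzRingType) (I : finType) (g : I -> R).

Lemma in_span0 : in_span g 0.
Proof. by exists (fun=> 0); rewrite big1 // => i _; rewrite mulr0. Qed.

Lemma in_spanD x y : in_span g x -> in_span g y -> in_span g (x + y).
Proof.
move=> [B ->] [B' ->]; exists (fun i => B i + B' i).
by rewrite -big_split; apply: eq_bigr => i _; rewrite mulrDr.
Qed.

Lemma in_spanMr x y : in_span g x -> in_span g (x * y).
Proof.
move=> [B ->]; exists (fun i => B i * y).
by rewrite mulr_suml; apply: eq_bigr => i _; rewrite mulrA.
Qed.

Lemma in_spanMl x y : in_span g y -> in_span g (x * y).
Proof. by rewrite mulrC; exact: in_spanMr. Qed.

Lemma in_span_sum (J : Type) (s : seq J) (P : pred J) (F : J -> R) :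
  (forall j, P j -> in_span g (F j)) -> in_span g (\sum_(j <- s | P j) F j).
Proof.
by move=> hF; elim/big_ind: _ => //; [exact: in_span0 | exact: in_spanD].
Qed.

Lemma in_span_gen i : in_span g (g i).
Proof.
exists (fun j => (j == i)%:R); rewrite (bigD1 i) //= eqxx mulr1 big1 ?addr0 // => j.
by move=> /negPf ->; rewrite mulr0.
Qed.

Lemma in_span_sqfree_eval (Om : finType) (K : comNzRingType) (phi : K -> R)
    (h : {ffun {set Om} -> K}) (z z' : Om -> R) :
  (forall o, in_span g (z' o - z o)) ->
  in_span g (sqfree_eval phi h z' - sqfree_eval phi h z).
Proof.
move=> hz; rewrite /sqfree_eval -sumrB; apply: in_span_sum => A _.
rewrite -mulrBr; apply: in_spanMl.
elim/big_rec2: _ => [|o y' y _ IH]; first by rewrite subrr; exact: in_span0.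
have -> : z' o * y - z o * y' = (z' o - z o) * y + z o * (y - y').
  by rewrite mulrBl mulrBr addrA subrK.
by apply: in_spanD; [exact: in_spanMr | exact: in_spanMl].
Qed.

End Span.

Section CoefForms.

Variables (n : nat) (K : fieldType).
Local Notation MP := {mpoly K[n]}.

Definition coef_forms (s j : nat) (y : {poly MP}) : Prop :=
  (forall i, y`_i \is s.-homog) /\ (size y <= j.+1)%N.

Lemma coef_formsM s j s' j' y y' :
  coef_forms s j y -> coef_forms s' j' y' -> coef_forms (s + s') (j + j') (y * y').
Proof.
move=> [hs hj] [hs' hj']; split.
  by move=> i; rewrite coefM; apply: rpred_sum => l _; apply: dhomogM.
by apply: leq_trans (size_polyMleq _ _) _; lia.
Qed.

Lemma coef_forms_prod (I : Type) (r : seq I) (s j : I -> nat) (y : I -> {poly MP}) :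
  (forall i, coef_forms (s i) (j i) (y i)) ->
  coef_forms (\sum_(i <- r) s i) (\sum_(i <- r) j i) (\prod_(i <- r) y i).
Proof.
move=> hy; elim: r => [|i r IH]; last by rewrite !big_cons; exact: coef_formsM.
rewrite !big_nil; split; last by rewrite size_poly1.
by move=> i; rewrite coef1; case: (i == _); rewrite ?dhomog1 ?rpred0.
Qed.

Lemma coef_formsD s j y y' :
  coef_forms s j y -> coef_forms s j y' -> coef_forms s j (y + y').
Proof.
move=> [hs hj] [hs' hj']; split; first by move=> i; rewrite coefD rpredD.
by apply: leq_trans (size_polyD _ _) _; rewrite geq_max hj.
Qed.

Lemma coef_forms0 s j : coef_forms s j 0.
Proof. by split; [move=> i; rewrite coef0 rpred0 | rewrite size_poly0]. Qed.

Lemma coef_forms_tensor_eval (d : nat) (T : {ffun 'I_d -> 'I_n} -> K)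
    (s j : 'I_d -> nat) (Y : 'I_d -> 'I_n -> {poly MP}) :
  (forall i l, coef_forms (s i) (j i) (Y i l)) ->
  coef_forms (\sum_i s i) (\sum_i j i) (tensor_eval (fun c => c%:MP%:P) T Y).
Proof.
move=> hY; apply: (big_ind (coef_forms _ _)) => [|y y'|k _].
- exact: coef_forms0.
- exact: coef_formsD.
rewrite -[X in coef_forms X]add0n -[X in coef_forms _ X]add0n.
apply: coef_formsM; last exact: coef_forms_prod.
split; last by rewrite size_polyC_leq1.
move=> i; rewrite coefC; case: (i == _); rewrite ?rpred0 //.
by rewrite -alg_mpolyC dhomogZ ?dhomog1.
Qed.

Lemma pihomogM (s d : nat) (p b : MP) : p \is s.-homog -> (s <= d)%N ->
  pihomog mdeg d (p * b) = p * pihomog mdeg (d - s) b.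
Proof.
move=> hp le_sd; pose k := maxn (msize b) (d - s).+1.
have {1}-> : b = \sum_(t < k) pihomog mdeg t b.
  by apply: pihomog_partitionE; rewrite leq_maxl.
have lt_k : (d - s < k)%N by rewrite leq_max leqnn orbT.
rewrite mulr_sumr raddf_sum (bigD1 (Ordinal lt_k)) //= pihomog_dE; last first.
  by rewrite -[X in X.-homog](subnKC le_sd) dhomogM ?pihomogP.
rewrite big1 ?addr0 // => t; rewrite -val_eqE /= => net.
apply: (@pihomog_ne0 _ _ _ (s + t)).
  by apply: contraNneq net => <-; rewrite addKn.
by rewrite dhomogM ?pihomogP.
Qed.

End CoefForms.

Lemma tensor_evalD (n d : nat) (K R : comNzRingType) (phi : K -> R)
    (T : {ffun 'I_d -> 'I_n} -> K) (Y Z : 'I_d -> 'I_n -> R) :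
  tensor_eval phi T (fun i l => Y i l + Z i l) =
  \sum_(S : {set 'I_d})
     tensor_eval phi T (fun i l => if i \in S then Y i l else Z i l).
Proof.
rewrite exchange_big /=; apply: eq_bigr => k _.
by rewrite bigA_distr mulr_sumr.
Qed.

Lemma tensor_eval_row0 (n d : nat) (K R : comNzRingType) (phi : K -> R)
    (T : {ffun 'I_d -> 'I_n} -> K) (Y : 'I_d -> 'I_n -> R) (i : 'I_d) :
  Y i =1 (fun=> 0) -> tensor_eval phi T Y = 0.
Proof.
by move=> Y0; apply: big1 => k _; rewrite (bigD1 i) //= Y0 mul0r mulr0.
Qed.

Lemma eq_tensor_eval (n d : nat) (K R : comNzRingType) (phi : K -> R)
    (T : {ffun 'I_d -> 'I_n} -> K) (Y Y' : 'I_d -> 'I_n -> R) :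
  (forall i l, Y i l = Y' i l) -> tensor_eval phi T Y = tensor_eval phi T Y'.
Proof.
by move=> eqY; apply: eq_bigr => k _; congr (_ * _); apply: eq_bigr.
Qed.

Lemma msize_tensor_eval (n d N : nat) (K : comNzRingType) (R : idomainType)
    (phi : K -> R) (T : {ffun 'I_d -> 'I_N} -> K) (Y : 'I_d -> 'I_N -> {mpoly R[n]}) :
  (forall i l, msize (Y i l) <= 2)%N ->
  (msize (tensor_eval (fun c => (phi c)%:MP) T Y) <= d.+1)%N.
Proof.
move=> hY; apply: leq_trans (mmeasure_sum _ _ _ _) _; apply/bigmax_leqP => k _.
apply: (@msizeM_leq _ 0 d); first by rewrite msizeC; case: eqP.
have := @msize_prod_leq n 1 R 'I_d predT (fun i => Y i (k i)).
by rewrite mul1n card_ord; apply.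
Qed.

Lemma msize_sqfree_eval (n D : nat) (Om : finType) (K : comNzRingType)
    (R : idomainType) (phi : K -> R) (h : {ffun {set Om} -> K})
    (z : Om -> {mpoly R[n]}) :
  (forall o, msize (z o) <= D.+1)%N ->
  (msize (sqfree_eval (fun c => (phi c)%:MP) h z) <= (D * #|Om|).+1)%N.
Proof.
move=> hz; apply: leq_trans (mmeasure_sum _ _ _ _) _; apply/bigmax_leqP => W _.
apply: (@msizeM_leq _ 0); first by rewrite msizeC; case: eqP.
by apply: leq_trans (msize_prod_leq W hz) _; rewrite ltnS leq_mul2l max_card orbT.
Qed.

Section Descent.

Variables (K : fieldType) (n e m k : nat) (f : {mpoly K[n]}).
Local Notation d := e.+1.
Local Notation MP := {mpoly K[n]}.
Local Notation Om := {ffun 'I_d -> 'I_m}.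

Let const : {rmorphism K -> {poly MP}} := polyC \o @mpolyC n K.
Let liftp : {rmorphism {poly K} -> {poly MP}} := map_poly (@mpolyC n K).

(* The generic point goes into every slot where [J] agrees with [J0], so it fills
   all the slots only if [J = J0]. *)
Definition pointed (v : 'I_d -> 'I_m -> 'I_n -> {poly K}) (J0 J : Om) i l :
    {poly MP} :=
  (if J i == J0 i then ('X_l)%:P else 0) + liftp (v i (J i) l).

Lemma sqfree_eval_pointed_eq0 (h : {ffun {set Om} -> K}) (Ev : seq {poly K})
    (v : 'I_d -> 'I_m -> 'I_n -> {poly K}) (J0 : Om) :
  uniq Ev -> (d * m ^ d < size Ev)%N -> (forall p, p \in Ev -> size p <= k)%N ->
  (forall i j l, size (v i j l) <= k)%N ->
  (forall v : 'I_d -> 'I_m -> 'I_n -> {poly K},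
     (forall i j l, size (v i j l) <= k)%N ->
      sqfree_eval polyC h
        (fun J => tensor_eval polyC (tensor f) (fun i => v i (J i))) = 0) ->
  sqfree_eval const h (fun J => tensor_eval const (tensor f) (pointed v J0 J)) = 0.
Proof.
move=> uE ltE hE hv h0.
pose c2 (c : K) : {mpoly {poly K}[n]} := (c%:P)%:MP.
pose Y2 (J : Om) i l : {mpoly {poly K}[n]} :=
  (if J i == J0 i then 'X_l else 0) + (v i (J i) l)%:MP.
pose g := sqfree_eval c2 h (fun J => tensor_eval c2 (tensor f) (Y2 J)).
have g0 : g = 0.
  apply: (mpoly_grid_eq0 uE) => [|x xE].
    apply: leq_trans ltE; have := @msize_sqfree_eval n d Om K _ polyC h.
    rewrite card_ffun !card_ord; apply=> J; apply: msize_tensor_eval => i l.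
    apply: leq_trans (mmeasureD_le _ _ _) _; rewrite geq_max; apply/andP; split.
      by case: eqP => _; rewrite ?msizeX ?mdeg1 // msize0.
    by rewrite msizeC; case: eqP.
  pose v' i j l := (if j == J0 i then x l else 0) + v i j l.
  rewrite -[RHS](h0 v'); last first.
    move=> i j l; apply: leq_trans (size_polyD _ _) _; rewrite geq_max hv andbT.
    by case: eqP => _; rewrite ?size_poly0 // hE.
  apply: sqfree_eval_morph => [c|J]; first exact: mevalC.
  apply: tensor_eval_morph => [c|i l]; first exact: mevalC.
  rewrite /= mevalD mevalC; congr (_ + _).
  by case: eqP => _; rewrite ?mevalXU ?meval0.
have <- : mmap liftp (fun l => ('X_l)%:P) g = 0 by rewrite g0 mmap0.
have mmapc c : mmap liftp (fun l => ('X_l)%:P) (c2 c) = const c.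
  by rewrite mmapC /= map_polyC.
apply/esym; apply: sqfree_eval_morph => // J; apply: tensor_eval_morph => // i l.
rewrite /= mmapD mmapC; congr (_ + _).
by case: eqP => _; rewrite ?mmapX ?mmap1U ?mmap0.
Qed.

Definition mixed (v : 'I_d -> 'I_m -> 'I_n -> {poly K}) (S : {set 'I_d})
    (J : 'I_d -> 'I_m) : {poly MP} :=
  tensor_eval const (tensor f)
    (fun i l => if i \in S then ('X_l)%:P else liftp (v i (J i) l)).

Lemma mixed_forms (v : 'I_d -> 'I_m -> 'I_n -> {poly K}) (S : {set 'I_d}) J :
  (forall i j l, size (v i j l) <= k.+1)%N ->
  coef_forms #|S| (d * k) (mixed v S J).
Proof.
move=> hv; rewrite -sum1_card big_mkcond.
have -> : (d * k = \sum_(i < d) k)%N by rewrite sum_nat_const card_ord.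
apply: coef_forms_tensor_eval => i l; case: (i \in S); split.
- move=> t; rewrite coefC; case: (t == _); last by rewrite rpred0.
  by rewrite dhomogX /= mdeg1.
- by apply: leq_trans (size_polyC_leq1 _) _.
- by move=> t; rewrite coef_map /= -alg_mpolyC dhomogZ ?dhomog1.
- by apply: leq_trans (size_poly _ _) _.
Qed.

Definition proper_part (S : {set 'I_d}) : bool := (S != set0) && (S != setT).

Definition slot_in (S : {set 'I_d}) : 'I_d := odflt ord0 [pick i in S].

Definition generator (j0 : 'I_m) (v : 'I_d -> 'I_m -> 'I_n -> {poly K})
    (q : {set 'I_d} * {ffun 'I_e -> 'I_m}) : {poly MP} :=
  if proper_part q.1 then mixed v q.1 (fill_slot j0 (slot_in q.1) q.2) else 0.

Lemma pointed_in_span j0 v (J0 J : Om) : f \is d.-homog ->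
  in_span (generator j0 v)
    (tensor_eval const (tensor f) (pointed v J0 J) -
     (liftp (tensor_eval polyC (tensor f) (fun i => v i (J i))) +
      (if J == J0 then (f *+ d`!)%:P else 0))).
Proof.
move=> hf; rewrite tensor_evalD (bigD1 set0) //= (bigD1 setT) /=; last first.
  by rewrite -card_gt0 cardsT card_ord.
set t0 := tensor_eval _ _ _; set t1 := tensor_eval _ _ _.
have -> : liftp (tensor_eval polyC (tensor f) (fun i => v i (J i))) = t0.
  apply: tensor_eval_morph => [c|i l]; first by rewrite /= map_polyC.
  by rewrite inE.
have -> : (if J == J0 then (f *+ d`!)%:P else 0) = t1.
  have [eqJ|neJ] := eqVneq J J0.
    rewrite -(tensor_eval_diag hf).
    apply: tensor_eval_morph => // i l.
    by rewrite inE eqJ eqxx.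
  have [i neJi] : exists i, J i != J0 i.
    apply/existsP; apply: contraNT neJ; rewrite negb_exists => /forallP eqJ.
    by apply/eqP/ffunP => i; apply/eqP; rewrite -[_ == _]negbK.
  rewrite /t1 (@tensor_eval_row0 _ _ _ _ _ _ _ i) // => l.
  by rewrite inE (negPf neJi).
rewrite addrA [X in in_span _ X]addrC addKr; apply: in_span_sum => S /andP[S0 ST].
have prS : proper_part S by rewrite /proper_part S0.
have slotS : slot_in S \in S.
  rewrite /slot_in; case: pickP => //= S_0; case/set0Pn: S0 => i iS.
  by have := S_0 i; rewrite iS.
case: (boolP [forall i in S, J i == J0 i]) => [/forall_inP agree|]; last first.
  rewrite negb_forall_in => /exists_inP[i iS neJi].
  rewrite (@tensor_eval_row0 _ _ _ _ _ _ _ i); first exact: in_span0.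
  by move=> l; rewrite iS (negPf neJi).
have -> : tensor_eval const (tensor f)
    (fun i l => if i \in S then if J i == J0 i then ('X_l)%:P else 0
                else liftp (v i (J i) l)) =
    generator j0 v (S, drop_slot (slot_in S) J).
  rewrite /generator /= prS; apply: eq_tensor_eval => i l.
  case: ifPn => [iS|niS]; first by rewrite agree.
  by rewrite drop_slotK //; apply: contraNneq niS => ->.
exact: in_span_gen.
Qed.

End Descent.

Lemma sum_of_products_fin (n : nat) (K : fieldType) (f : {mpoly K[n]}) (I : finType)
    (a b : I -> {mpoly K[n]}) :
  (forall i, posdeg_form (a i) /\ posdeg_form (b i)) -> f = \sum_i a i * b i ->
  sum_of_products f #|I|.
Proof.
move=> hab ->; exists (fun i => a (enum_val i)), (fun i => b (enum_val i)).
split=> [i|]; first exact: hab.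
by rewrite (reindex (@enum_val _ I)) //; apply/onW_bij/enum_val_bij.
Qed.

Lemma sum_of_products_coef (n : nat) (K : fieldType) (d D : nat) (f : {mpoly K[n]})
    (c : {poly K}) (I : finType) (s : I -> nat) (g : I -> {poly {mpoly K[n]}}) :
  f \is d.-homog -> c != 0 -> (forall i, g i != 0 -> (0 < s i < d)%N) ->
  (forall i, coef_forms (s i) D (g i)) ->
  in_span g (f%:P * map_poly (@mpolyC n K) c) ->
  sum_of_products f (#|I| * D.+1).
Proof.
move=> hf nzc hs hg [B defB].
have [q nzq] : exists q, c`_q != 0.
  by exists (size c).-1; rewrite -lead_coefE lead_coef_eq0.
pose b (p : I * 'I_D.+1) : {mpoly K[n]} :=
  if (g p.1 != 0) && (p.2 <= q)%N
  then (c`_q)^-1 *: pihomog mdeg (d - s p.1) (B p.1)`_(q - p.2) else 0.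
have -> : (#|I| * D.+1 = #|{: I * 'I_D.+1}|)%N by rewrite card_prod card_ord.
have zero_form : posdeg_form (0 : {mpoly K[n]}) by exists 1%N; rewrite ?rpred0.
apply: (@sum_of_products_fin n K f _ (fun p : I * 'I_D.+1 => (g p.1)`_p.2) b).
  move=> [i t].
  rewrite /b /=; have [->|/hs/andP[s_gt0 s_lt]] := eqVneq (g i) 0.
    by rewrite coef0.
  split; first by exists (s i) => //; case: (hg i).
  case: ifP => _ //; exists (d - s i)%N; first by rewrite subn_gt0.
  by rewrite dhomogZ ?pihomogP.
have def_f : f = (c`_q)^-1 *: pihomog mdeg d (f%:P * map_poly (@mpolyC n K) c)`_q.
  rewrite coefCM coef_map /= mulrC mul_mpolyC linearZ /= pihomog_dE // scalerA.
  by rewrite mulVf ?scale1r.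
rewrite {1}def_f defB coef_sum (raddf_sum (pihomog mdeg d)) scaler_sumr /=.
rewrite -(pair_bigA _ (fun i (t : 'I_D.+1) => (g i)`_t * b (i, t))) /=.
apply: eq_bigr => i _; have [hgi szgi] := hg i.
have [gi0|nzgi] := eqVneq (g i) 0.
  rewrite gi0 mul0r coef0 raddf0 scaler0 big1 // => t _.
  by rewrite coef0 mul0r.
have /andP[_ s_lt] := hs i nzgi.
rewrite coefM (raddf_sum (pihomog mdeg d)) scaler_sumr /=.
pose F t := if (t <= q)%N
  then (c`_q)^-1 *: ((g i)`_t * pihomog mdeg (d - s i) (B i)`_(q - t)) else 0.
have F0 N : (size (g i) <= N)%N -> \sum_(t < N) F t = \sum_(t < size (g i)) F t.
  move=> leN; rewrite -(big_mkord predT F) (big_cat_nat (leq0n _) leN) //= big_mkord.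
  rewrite [X in _ + X]big_nat_cond [X in _ + X]big1 ?addr0 // => t.
  move=> /andP[/andP[let_ _] _].
  by rewrite /F [(g i)`_t]nth_default // mul0r scaler0 if_same.
transitivity (\sum_(t < q.+1) F t).
  apply: eq_bigr => t _; rewrite /F -ltnS ltn_ord.
  by rewrite (pihomogM _ (hgi t)) // ltnW.
transitivity (\sum_(t < D.+1) F t); last first.
  apply: eq_bigr => t _; rewrite /F /b nzgi /=; case: ifP => _; last by rewrite mulr0.
  by rewrite scalerAr.
have Fq N : (q.+1 <= N)%N -> \sum_(t < N) F t = \sum_(t < q.+1) F t.
  move=> leN; rewrite -(big_mkord predT F) (big_cat_nat (leq0n _) leN) //= big_mkord.
  rewrite [X in _ + X]big_nat_cond [X in _ + X]big1 ?addr0 // => t.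
  move=> /andP[/andP[lt_qt _] _].
  by rewrite /F leqNgt lt_qt.
rewrite (F0 D.+1) // -(F0 (maxn q.+1 (size (g i)))) ?leq_maxr //.
by rewrite Fq ?leq_maxl.
Qed.

Lemma sum_of_products_relation (K : fieldType) (n e m k : nat) (f : {mpoly K[n]})
    (Ev : seq {poly K}) (h : {ffun {set {ffun 'I_e.+1 -> 'I_m}} -> K}) :
  f \is (e.+1).-homog -> (e.+1)`!%:R != 0 :> K -> (0 < m)%N ->
  uniq Ev -> (e.+1 * m ^ e.+1 < size Ev)%N ->
  (forall p, p \in Ev -> size p <= k.+1)%N -> h != 0 ->
  (forall v : 'I_e.+1 -> 'I_m -> 'I_n -> {poly K},
     (forall i j l, size (v i j l) <= k.+1)%N ->
     sqfree_eval polyC h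
       (fun J => tensor_eval polyC (tensor f) (fun i => v i (J i))) = 0) ->
  sum_of_products f (2 ^ e.+1 * m ^ e * (e.+1 * k).+1).
Proof.
move=> hf nzd m_gt0 uE ltE hE nzh h0; pose d := e.+1; pose j0 := Ordinal m_gt0.
pose V := {v : 'I_d -> 'I_m -> 'I_n -> {poly K} |
  forall i j l, (size (v i j l) <= k.+1)%N}.
have zV : V by exists (fun _ _ _ => 0) => i j l; rewrite size_poly0.
pose z (v : V) (J : {ffun 'I_d -> 'I_m}) : {poly K} :=
  tensor_eval polyC (tensor f) (fun i => sval v i (J i)).
have [h1 [J0 [[v hv] [h1_0 nz]]]] :=
  @sqfree_relation_descent _ K _ polyC V zV z h nzh (fun v => h0 _ (svalP v)).
pose c := sqfree_eval polyC (sqfree_deriv J0 h1) (z (exist _ v hv)).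
have -> : (2 ^ d * m ^ e = #|{: {set 'I_d} * {ffun 'I_e -> 'I_m}}|)%N.
  rewrite card_prod card_ffun !card_ord -cardsT -powersetT card_powerset.
  by rewrite cardsT card_ord.
apply: (@sum_of_products_coef _ _ d _ _ (d`!%:R *: c) _
   (fun q : {set 'I_d} * {ffun 'I_e -> 'I_m} => #|q.1|) (generator f j0 v)) => //.
- by rewrite scaler_eq0 negb_or nzd.
- move=> [S J]; rewrite /generator /=; case: ifP => [/andP[S0 ST] _|]; last first.
    by rewrite eqxx.
  rewrite card_gt0 S0 -[X in (_ < X)%N](card_ord d) -cardsT.
  by rewrite proper_card // properT.
- move=> [S J]; rewrite /generator /=; case: ifP => [_|_]; last exact: coef_forms0.
  exact: mixed_forms.
have eval0 := sqfree_eval_pointed_eq0 J0 uE ltE hE hv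
  (fun v hv => h1_0 (exist _ v hv)).
have := in_span_sqfree_eval (polyC \o @mpolyC n K) h1
  (fun J => pointed_in_span j0 v J0 J hf).
rewrite eval0 sqfree_eval_shift.
pose liftp : {rmorphism {poly K} -> {poly {mpoly K[n]}}} := map_poly (@mpolyC n K).
have liftE h' : liftp (sqfree_eval polyC h' (z (exist _ v hv))) =
    sqfree_eval (polyC \o @mpolyC n K) h'
      (fun J => liftp (tensor_eval polyC (tensor f) (fun i => v i (J i)))).
  by apply: sqfree_eval_morph => // a; rewrite /= map_polyC.
rewrite -!liftE h1_0 rmorph0 !add0r => /(in_spanMl (-1)).
rewrite mulN1r opprK; congr in_span.
rewrite [map_poly _ (_ *: _)](_ : _ = liftp c *+ d`!); last first.
  by rewrite scaler_nat -/liftp raddfMn.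
by rewrite mulrnAr polyCMn mulrnAl.
Qed.

(** * Strength *)

(* Imported only here: these files rebind the notations of [finset]. *)
From mathcomp Require Import boolp classical_sets cardinality reals exp.
Import Order.TTheory Num.Theory.

Lemma factorial_neq0 (K : fieldType) (d : nat) :
  [pchar K] =i pred0 \/ (exists2 p : nat, p \in [pchar K] & (d < p)%N) ->
  d`!%:R != 0 :> K.
Proof.
case=> [K0|[p pK ltdp]].
  by apply/negP => /(natf0_pchar (fact_gt0 d))[p]; rewrite K0.
rewrite -(dvdn_pcharf pK); have p_pr := pcharf_prime pK.
elim: d ltdp => [|d IH] ltdp; first by rewrite dvdn1 gtn_eqF ?prime_gt1.
by rewrite factS Euclid_dvdM // negb_or gtnNdvd //= IH // ltnW.
Qed.

Lemma strength_le (n : nat) (K : fieldType) (f : {mpoly K[n]}) (s : nat) :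
  sum_of_products f s -> exists2 s', strength f = Some s' & (s' <= s)%N.
Proof.
move=> fs; rewrite /strength; case: pselect => [ex|[]]; last by exists s; apply/asboolP.
by case: ex_minnP => s' _ min_s'; exists s' => //; apply: min_s'; apply/asboolP.
Qed.

Lemma strength_sum_of_products (n : nat) (K : fieldType) (f : {mpoly K[n]}) (r : nat) :
  strength f = Some r -> sum_of_products f r.
Proof.
rewrite /strength; case: pselect => // ex [<-].
by case: ex_minnP => s /asboolP.
Qed.

Lemma posdeg_form_mcoeff0 (n : nat) (K : fieldType) (p : {mpoly K[n]}) :
  posdeg_form p -> p@_0%MM = 0.
Proof.
by case=> e e_gt0 hp; rewrite (dhomog_nemf_coeff hp) //= mdeg0 eq_sym -lt0n.
Qed.

Lemma sum_of_products_descent (K L : fieldType) (iota : {rmorphism K -> L})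
    (n e r k : nat) (Ev : seq {poly K}) (f : {mpoly K[n]}) :
  f \is (e.+1).-homog -> (e.+1)`!%:R != 0 :> K -> (0 < r)%N ->
  sum_of_products (map_mpoly iota f) r ->
  uniq Ev -> (e.+1 * (12 * 2 ^ e.+1 * r) ^ e.+1 < size Ev)%N ->
  (forall p, p \in Ev -> size p <= k.+1)%N ->
  sum_of_products f (2 ^ e.+1 * (12 * 2 ^ e.+1 * r) ^ e * (e.+1 * k).+1).
Proof.
move=> hf nzd r_gt0 [a [b [hab def_f]]] uE ltE hE.
set m := (12 * 2 ^ e.+1 * r)%N in ltE *.
have m_gt0 : (0 < m)%N by rewrite !muln_gt0 expn_gt0.
have [|||||h nzh h0] := @tensor_relation _ _ iota n e r m f a b.
- by move=> i; have [/posdeg_form_mcoeff0] := hab i.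
- by move=> i; have [_ /posdeg_form_mcoeff0] := hab i.
- exact: def_f.
- exact: m_gt0.
- by rewrite (expnS m) mulnA leq_mul2r /m; apply/orP; right; lia.
exact: sum_of_products_relation hf nzd m_gt0 uE ltE hE nzh (fun v _ => h0 v).
Qed.

Lemma many_polys (K : fieldType) (k : nat) :
  exists E : seq {poly K}, [/\ uniq E, size E = (2 ^ k)%N &
    forall p, p \in E -> (size p <= k)%N].
Proof.
pose P (W : {set 'I_k}) : {poly K} :=
  \poly_(i < k) (i \in [seq val j | j <- enum W])%:R.
exists [seq P W | W : {set 'I_k}]; split.
- rewrite map_inj_uniq ?enum_uniq // => U W eqUW; apply/setP => i.
  have := congr1 (fun p : {poly K} => p`_i) eqUW.
  rewrite /= !coef_poly ltn_ord !(mem_map val_inj) !mem_enum.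
  by case: (i \in U); case: (i \in W) => // /eqP; rewrite ?oner_eq0 // eq_sym oner_eq0.
- by rewrite size_map -cardE -cardsT -powersetT card_powerset cardsT card_ord.
by move=> p /mapP[W _ ->]; apply: size_poly.
Qed.

Lemma many_constants (K : fieldType) (N : nat) : infinite_set (@setT K) ->
  exists E : seq {poly K}, [/\ uniq E, (N <= size E)%N &
    forall p, p \in E -> (size p <= 1)%N].
Proof.
move=> /(infinite_set_fset N)[B _ leN].
exists [seq c%:P | c <- finmap.enum_fset B]; split; last 1 first.
- by move=> p /mapP[c _ ->]; apply: size_polyC_leq1.
- by rewrite map_inj_uniq ?finmap.fset_uniq //; apply: polyC_inj.
by rewrite size_map.
Qed.

Lemma log2_ge1 (R : realType) (x : R) : 2 <= x -> 1 <= log2 x.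
Proof.
move=> le2x; have ln2 : 0 < ln (2 : R) by rewrite ln_gt0 // ltr1n.
by rewrite /log2 ler_pdivlMr // mul1r ler_ln ?posrE // (lt_le_trans _ le2x).
Qed.

Lemma le_log2 (R : realType) (k c d : nat) (x : R) : 2 <= x ->
  2 ^+ k <= c%:R * x ^+ d -> (k%:R <= (c + d)%:R * log2 x).
Proof.
move=> le2x le_k; have x_gt0 : 0 < x by apply: lt_le_trans le2x.
have ln2 : 0 < ln (2 : R) by rewrite ln_gt0 // ltr1n.
have le_c : c%:R <= 2 ^+ c :> R by rewrite -natrX ler_nat ltnW // ltn_expl.
have : ln (2 ^+ k) <= ln (2 ^+ c * x ^+ d :> R).
  rewrite ler_ln ?posrE ?mulr_gt0 ?exprn_gt0 //; apply: le_trans le_k _.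
  by rewrite ler_wpM2r // exprn_ge0 // ltW.
rewrite lnM ?posrE ?exprn_gt0 // !lnXn // => le_ln.
have -> : k%:R = (ln (2 : R) *+ k) / ln 2 by rewrite mulrnAl divff // gt_eqF.
apply: (@le_trans _ _ ((ln (2 : R) *+ c + ln x *+ d) / ln 2)).
  by rewrite ler_wpM2r // invr_ge0 ltW.
rewrite mulrDl natrD mulrDl lerD //.
  rewrite -[ln 2 *+ c]mulr_natl -mulrA divff ?gt_eqF // mulr1.
  by rewrite -[X in X <= _]mulr1 ler_wpM2l // log2_ge1.
by rewrite /log2 mulrA mulr_natl.
Qed.


Theorem theorem1p3 (R : realType) (d : nat) (d_ge1 : (1 <= d)%N) :
  exists C : R, 0 < C /\
    forall (K : fieldType),
      ([pchar K] =i pred0 \/ exists2 p : nat, p \in [pchar K] & (d < p)%N) ->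
    forall (L : closedFieldType) (iota : {rmorphism K -> L}),
      is_algebraic_closure iota ->
    forall (n : nat), (1 <= n)%N ->
    forall (f : {mpoly K[n]}), f \is d.-homog ->
    forall (r : nat), strength (map_mpoly iota f) = Some r ->
      (infinite_set (@setT K) ->
         exists2 s : nat, strength f = Some s & s%:R <= C * r%:R ^+ d.-1) /\
      (finite_set (@setT K) ->
         exists2 s : nat, strength f = Some s &
           s%:R <= C * r%:R ^+ d.-1 * log2 (r%:R + 1)).
Proof.
case: d d_ge1 => // e _.
pose c0 := (2 ^ e.+1 * (12 * 2 ^ e.+1) ^ e)%N.
pose c1 := (e.+1 * (12 * 2 ^ e.+1) ^ e.+1)%N.
pose c := (c0 * (e.+1 * (c1 + e.+1)).+1)%N.
have c_gt0 : (0 < c)%N by rewrite !(muln_gt0, expn_gt0).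
exists c%:R; split; first by rewrite ltr0n.
move=> K charK L iota _ n _ f hf r /strength_sum_of_products hr.
have nzd := factorial_neq0 charK.
case: (posnP r) hr => [-> [a [b [_ f0]]]|r_gt0 hr].
  have sf0 : sum_of_products f 0.
    exists (fun=> 0), (fun=> 0); split=> [[]//|]; rewrite big_ord0.
    apply/mpolyP => m; apply: (fmorph_inj iota); rewrite -mcoeff_map_mpoly f0.
    by rewrite big_ord0 !mcoeff0 rmorph0.
  have [s sf] := strength_le sf0; rewrite leqn0 => /eqP s0; rewrite {}s0 in sf.
  split=> _; exists 0%N => //; first by rewrite mulr_ge0 // exprn_ge0.
  by rewrite add0r /log2 ln1 mul0r mulr0.
set B := (e.+1 * (12 * 2 ^ e.+1 * r) ^ e.+1)%N.
have le2r : 2 <= r%:R + 1 :> R by rewrite natr1 ler_nat.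
have boundE k : (2 ^ e.+1 * (12 * 2 ^ e.+1 * r) ^ e * (e.+1 * k).+1 =
    c0 * (e.+1 * k).+1 * r ^ e)%N.
  by rewrite /c0 expnMn; lia.
split=> hK.
  have [Ev [uE leE hE]] := many_constants B.+1 hK.
  have [s sf les] :=
    strength_le (sum_of_products_descent hf nzd r_gt0 hr uE leE hE).
  exists s => //; rewrite -natrX -natrM ler_nat; apply: leq_trans les _.
  by rewrite boundE muln0 muln1 leq_mul2r leq_pmulr ?orbT.
pose k := trunc_log 2 B.
have B_gt0 : (0 < B)%N by rewrite !(muln_gt0, expn_gt0) r_gt0.
have [Ev [uE szE hE]] := many_polys K k.+1.
have ltE : (B < size Ev)%N by rewrite szE trunc_log_ltn.
have [s sf les] := strength_le (sum_of_products_descent hf nzd r_gt0 hr uE ltE hE).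
exists s => //; apply: (@le_trans _ _ (c0 * (e.+1 * k).+1 * r ^ e)%N%:R).
  by rewrite ler_nat -boundE.
have le_k : k%:R <= (c1 + e.+1)%:R * log2 (r%:R + 1) :> R.
  apply: le_log2 => //; rewrite natr1 -!natrX -natrM ler_nat.
  apply: leq_trans (trunc_logP _ B_gt0) _ => //.
  by rewrite /B /c1 [((_ * r) ^ _)%N]expnMn mulnA leq_mul2l leq_exp2r // leqnSn orbT.
have le1 := log2_ge1 le2r.
have le_dk : (e.+1 * k).+1%:R <= (e.+1 * (c1 + e.+1)).+1%:R * log2 (r%:R + 1) :> R.
  rewrite -!natr1 mulrDl mul1r lerD // !natrM -mulrA.
  by rewrite ler_wpM2l.
rewrite /c {c c_gt0}; clearbody c0 c1.
rewrite natrM (natrM _ c0) natrX (natrM _ c0) -!mulrA ler_wpM2l //.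
by rewrite [leRHS]mulrCA [leLHS]mulrC ler_wpM2l // exprn_ge0.
Qed.
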